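(* Let $I=[a,b]\subset\mathbb{R}$ with $a\neq b$, let $H\in C^\infty(\mathbb{R}^6,\mathbb{R})$, let $\hat{\mathcal{L}}_H$ be the van Hove-Liouvillian operator $\hat{\mathcal L}_H\chi=i\hbar\{H,\chi\}+\left(H-\tfrac12 z\cdot\nabla H\right)\chi$, and let $\hat{\mathbb{P}}$ be the Koopman-van Hove linear momentum operator $$\hat{\mathbb P}(\chi)(z)=-i\hbar\frac{\partial\chi}{\partial q}(z)+\frac12\,p\,\chi(z).$$ Let $(\chi_t)_{t\in I}$ be an element of $\mathcal{H}_{vH}$ (a van Hove classical wave function) that solves the van Hove-Liouvillian equation $i\hbar\,\partial_t\chi_t=\hat{\mathcal{L}}_H\chi_t$. Then, for all $t\in I$ and $z=(q,p)\in\mathbb{R}^6$: (i) $$\frac{d}{dt}\hat{\mathbb{P}}(\chi_t)(z)=-\left(\frac{\partial}{\partial q}+\frac{i}{2\hbar}p\right)\hat{\mathcal{L}}_H(\chi_t)(z)=-\frac{i}{\hbar}\left(\hat{\mathbb{P}}\circ\hat{\mathcal{L}}_H\right)(\chi_t)(z);$$ (ii) $$\frac{d}{dt}\langle\hat{\mathbb{P}}\rangle(\chi_t)=\frac{2}{\hbar}\,\mathrm{Im}\left[\langle\hat{\mathbb{P}}(\chi_t)\,|\,\hat{\mathcal{L}}_H(\chi_t)\rangle\right]$$ (componentwise in $\mathbb{R}^3$).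
   Context: Phase space is $\mathbb{R}^6$ with points $z=(q,p)$, $q,p\in\mathbb{R}^3$; $\hbar>0$ is a constant. $\partial/\partial q,\partial/\partial p$ are the gradients in $q,p$. The Poisson bracket is $\{F,G\}=\frac{\partial F}{\partial q}\cdot\frac{\partial G}{\partial p}-\frac{\partial F}{\partial p}\cdot\frac{\partial G}{\partial q}$, and $z\cdot\nabla H=q\cdot\frac{\partial H}{\partial q}+p\cdot\frac{\partial H}{\partial p}$. The inner product is $\langle\chi_1|\chi_2\rangle=\int_{\mathbb{R}^6}\chi_1^*(z)\chi_2(z)\,dz$, and for an operator $\hat A$ its average is $\langle\hat A\rangle(\chi):=\langle\chi|\hat A\chi\rangle$ (componentwise for vector-valued operators). $\mathcal{H}_{vH}$, the set of van Hove classical wave functions, consists of the functions $\chi:\mathbb{R}^6\times I\to\mathbb{C}$, $\chi_t:=\chi(\cdot,t)$, such that $\chi_t\in L^2(\mathbb{R}^6)$ for all $t$, $\chi(z,\cdot)$ is smooth for all $z$, $\lim_{|z|\to\infty}\chi_t(z)=0$ for all $t$, and $|\chi_t|^2+\mathrm{div}(\chi_t^*\hat{\mathcal{Z}}\chi_t)=\rho_t$ is a probability density on $\mathbb{R}^6$, where $\hat{\mathcal{Z}}\chi=\frac12 z\chi-i\hbar\,\mathbb{J}\nabla\chi$ and $\mathbb{J}(u,v)=(v,-u)$ for $u,v\in\mathbb{R}^3$. Wave functions are taken smooth in $(z,t)$ and decaying sufficiently for all expressions to be defined, for differentiation under the integral sign, and for the components of $\hat{\mathbb{P}}$ and $\hat{\mathcal{L}}_H$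 to act symmetrically with respect to $\langle\cdot|\cdot\rangle$ (they are regarded as Hermitian operators). *)

(* Defs.v *)
From HB Require Import structures.
From mathcomp Require Import all_boot all_order all_algebra.
From mathcomp Require Import complex.
From mathcomp Require Import all_classical all_reals all_analysis.
Set Implicit Arguments.
Unset Strict Implicit.
Unset Printing Implicit Defensive.
Import Order.TTheory GRing.Theory Num.Theory.
Import numFieldNormedType.Exports.
Local Open Scope classical_set_scope.
Local Open Scope complex_scope.
Local Open Scope ring_scope.

(* Mathematical Components, with Analysis for the reals and the integral and
   real-closed's [R[i]] for the complex numbers.  In [complex_scope], ['i] is
   the imaginary unit and [x%:C] embeds the reals; [conjc] is conjugation. *)

(* A point z = (q, p) is the row [row_mx q p]. *)
Definition phase (R : realType) : Type := 'rV[R]_(3 + 3).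

Section Smoothness.
Context {R : realType} {V : normedModType R}.

Fixpoint C_n (n : nat) (f : V -> R) : Prop :=
  match n with
  | 0 => continuous f
  | m.+1 => (forall x, differentiable f x) /\ forall v, C_n m ('D_v f)
  end.

Definition smooth (f : V -> R) : Prop := forall n, C_n n f.

Definition smoothC (f : V -> R[i]) : Prop :=
  smooth (fun x => complex.Re (f x)) /\ smooth (fun x => complex.Im (f x)).

(* Smoothness on a closed set, in the usual sense of having a smooth
   extension; it only depends on the values of [f] on [A]. *)
Definition smoothC_on (A : set V) (f : V -> R[i]) : Prop :=
  exists2 F, smoothC F & forall x, A x -> F x = f x.

End Smoothness.

Section TimeDerivative.
Context {R : realType}.
Implicit Types (I : set R) (f : R -> R[i]) (t : R).

(* The derivative at [t] of a function on [I]: the difference quotient only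
   ranges over [I], so it is one-sided at the end points of an interval. *)
Definition quotient f t (s : R) : R[i] := (f s - f t) / (s - t)%:C.

Definition has_dt I f t (d : R[i]) : Prop :=
  complex.Re (quotient f t s) @[s --> within I t^'] --> complex.Re d /\
  complex.Im (quotient f t s) @[s --> within I t^'] --> complex.Im d.

Definition dt I f t : R[i] :=
  lim (complex.Re (quotient f t s) @[s --> within I t^']) +i*
  lim (complex.Im (quotient f t s) @[s --> within I t^']).

Definition has_dt_vec n I (f : R -> 'rV[R[i]]_n) t (d : 'rV[R[i]]_n) : Prop :=
  forall j, has_dt I (fun s => f s 0 j) t (d 0 j).

End TimeDerivative.

Section PhaseSpaceCalculus.
Context {R : realType}.
Local Notation C := R[i].
Local Notation Z := (phase R).
Implicit Types (F G : Z -> C) (z : Z).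

Definition qpart z : 'rV[C]_3 := \row_j (lsubmx z 0 j)%:C.
Definition ppart z : 'rV[C]_3 := \row_j (rsubmx z 0 j)%:C.
Definition zC z : 'rV[C]_(3 + 3) := row_mx (qpart z) (ppart z).

Definition partial (k : 'I_(3 + 3)) F z : C :=
  'D_(delta_mx 0 k) (fun w => complex.Re (F w)) z +i*
  'D_(delta_mx 0 k) (fun w => complex.Im (F w)) z.

Definition grad F z : 'rV[C]_(3 + 3) := \row_k partial k F z.
Definition grad_q F z : 'rV[C]_3 := lsubmx (grad F z).
Definition grad_p F z : 'rV[C]_3 := rsubmx (grad F z).

Definition div (X : Z -> 'rV[C]_(3 + 3)) z : C :=
  \sum_k partial k (fun w => X w 0 k) z.

Definition dot n (u v : 'rV[C]_n) : C := \sum_k u 0 k * v 0 k.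

Definition poisson F G z : C :=
  dot (grad_q F z) (grad_p G z) - dot (grad_p F z) (grad_q G z).

Definition symplectic (w : 'rV[C]_(3 + 3)) : 'rV[C]_(3 + 3) :=
  row_mx (rsubmx w) (- lsubmx w).

End PhaseSpaceCalculus.

Section Integration.
Context {R : realType}.
Local Notation C := R[i].
Local Notation Z := (phase R).

(* Lebesgue measure on R^6 is the product of six copies of Lebesgue measure on
   the line; [of_coords] carries the product of lines to phase space.  The
   product is nested to the left because that is how the library infers its
   measure structure. *)
Local Notation line := (measurableTypeR R).
Local Notation line6 := (line * line * line * line * line * line)%type.

Definition of_coords (x : line6) : Z :=
  let: (q1, q2, q3, p1, p2, p3) := x in
  \row_k nth 0 [:: q1; q2; q3; p1; p2; p3] k.

Local Notation leb := (@lebesgue_measure R).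
Definition mu6 : {measure set line6 -> \bar R} :=
  (leb \x leb \x leb \x leb \x leb \x leb)%E.

Definition integrable_R6 (f : Z -> R) : Prop :=
  mu6.-integrable setT (fun x => (f (of_coords x))%:E).

Definition integrableC (f : Z -> C) : Prop :=
  integrable_R6 (fun z => complex.Re (f z)) /\
  integrable_R6 (fun z => complex.Im (f z)).

Definition integral_R6 (f : Z -> R) : R :=
  \int[mu6]_(x in setT) f (of_coords x).

Definition integralC (f : Z -> C) : C :=
  integral_R6 (fun z => complex.Re (f z)) +i*
  integral_R6 (fun z => complex.Im (f z)).

Definition measurableC (f : Z -> C) : Prop :=
  measurable_fun setT (fun x : line6 => complex.Re (f (of_coords x))) /\
  measurable_fun setT (fun x : line6 => complex.Im (f (of_coords x))).

Definition square_integrable (f : Z -> C) : Prop :=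
  measurableC f /\ integrable_R6 (fun z => complex.Re (`|f z| ^+ 2)).

Definition probability_density (rho : Z -> R) : Prop :=
  [/\ forall z, 0 <= rho z, integrable_R6 rho & integral_R6 rho = 1].

Definition bracket (f g : Z -> C) (z : Z) : C := conjc (f z) * g z.

Definition inner (f g : Z -> C) : C := integralC (bracket f g).

Definition component n (A : (Z -> C) -> Z -> 'rV[C]_n) (j : 'I_n)
    (f : Z -> C) (z : Z) : C := A f z 0 j.

Definition average n (A : (Z -> C) -> Z -> 'rV[C]_n) (f : Z -> C) : 'rV[C]_n :=
  \row_j inner f (component A j f).

(* [A] acts symmetrically on the pair [f], [g]; the two inner products are
   required to be given by convergent integrals. *)
Definition symmetric_at (A : (Z -> C) -> Z -> C) (f g : Z -> C) : Prop :=
  [/\ integrableC (bracket (A f) g), integrableC (bracket f (A g))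
    & inner (A f) g = inner f (A g)].

End Integration.

Section VanHove.
Context {R : realType}.
Local Notation C := R[i].
Local Notation Z := (phase R).
Implicit Types (hbar a b : R) (H : Z -> R) (f : Z -> C) (chi : R -> Z -> C).

Definition realC H : Z -> C := fun z => (H z)%:C.

Definition liouvillian hbar H f z : C :=
  'i%C * hbar%:C * poisson (realC H) f z
  + (realC H z - 2^-1 * dot (zC z) (grad (realC H) z)) * f z.

Definition momentum hbar f z : 'rV[C]_3 :=
  - ('i%C * hbar%:C) *: grad_q f z + (2^-1 * f z) *: ppart z.

Definition Zhat hbar f z : 'rV[C]_(3 + 3) :=
  (2^-1 * f z) *: zC z - ('i%C * hbar%:C) *: symplectic (grad f z).

(* A time-dependent wave function is written chi t z; only the times t in
   [a, b] are ever constrained. *)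
Record van_hove_wave hbar a b chi : Prop := {
  wave_L2 : forall t, t \in `[a, b] -> square_integrable (chi t);
  wave_smooth_time :
    forall z, smoothC_on `[a, b]%classic (fun t => chi t z);
  wave_vanishes : forall t, t \in `[a, b] -> forall eps : R, 0 < eps ->
    exists M : R, forall z : Z, M < `|z| -> `|chi t z| < eps%:C;
  wave_density : forall t, t \in `[a, b] ->
    exists2 rho : Z -> R, probability_density rho & forall z,
      `|chi t z| ^+ 2
      + div (fun w => conjc (chi t w) *: Zhat hbar (chi t) w) z = (rho z)%:C }.

(* The standing assumptions of regularity and decay: joint smoothness in (z, t),
   convergence of the integrals, a dominating function allowing to
   differentiate the average of the momentum under the integral sign, and
   symmetry of the momentum components and of the Liouvillian on the wave
   functions they meet in the time evolution of that average. *)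
Record regular_decaying hbar H a b chi : Prop := {
  jointly_smooth : smoothC_on ([set: Z] `*` `[a, b]%classic)
    (fun zt : Z * R => chi zt.2 zt.1);
  average_defined : forall t, t \in `[a, b] -> forall j,
    integrableC (bracket (chi t) (component (momentum hbar) j (chi t)));
  average_dominated : forall j, exists2 g : Z -> R, integrable_R6 g &
    forall t, t \in `[a, b] -> forall z,
      `|dt `[a, b]%classic (fun s =>
          bracket (chi s) (component (momentum hbar) j (chi s)) z) t|
      <= (g z)%:C;
  momentum_symmetric : forall t, t \in `[a, b] -> forall j,
    symmetric_at (component (momentum hbar) j)
      (chi t) (liouvillian hbar H (chi t));
  liouvillian_symmetric : forall t, t \in `[a, b] -> forall j,
    symmetric_at (liouvillian hbar H)
      (chi t) (component (momentum hbar) j (chi t)) }.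

Definition solves_liouville hbar H a b chi : Prop :=
  forall t, t \in `[a, b] -> forall z,
    'i%C * hbar%:C * dt `[a, b]%classic (fun s => chi s z) t
    = liouvillian hbar H (chi t) z.

End VanHove.

(* Main.v *)
(* For t in I, chi_t(z) = F(z, t) with F smooth on all of R^6 times R.  The
   equation says d chi_t/dt = -(i/hbar) L chi_t; momentum commutes with the
   time derivative because mixed partial derivatives of F agree, which is (i).
   For (ii), the time derivative of the integrand conj(chi) P chi is, by (i),
   (i/hbar) (conj(b) - b') with b = conj(P chi) L chi and
   b' = conj(chi) P(L chi); b and b' have the same integral w since P is
   symmetric, so the average has derivative (i/hbar) (conj w - w), that is,
   (2/hbar) Im w.  The given domination of the time derivative bounds the
   difference quotients, by the mean value theorem, and the limit passes under
   the integral sign by dominated convergence. *)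
Require Import Defs.
From HB Require Import structures.
From mathcomp Require Import all_boot all_order all_algebra.
From mathcomp Require Import complex.
From mathcomp Require Import all_classical all_reals all_analysis.
From mathcomp Require Import measurable_realfun ring.
Set Implicit Arguments.
Unset Strict Implicit.
Unset Printing Implicit Defensive.
Import Order.TTheory GRing.Theory Num.Theory.
Import numFieldNormedType.Exports.
Local Open Scope classical_set_scope.
Local Open Scope complex_scope.
Local Open Scope ring_scope.

(** * Directional derivatives and the symmetry of second derivatives *)

Lemma is_derive_line (R : realType) (V W : normedModType R) (f : V -> W)
    (x u : V) (s : R) (d : W) :
  is_derive (x + s *: u) u f d -> is_derive s 1 (fun r => f (x + r *: u)) d.
Proof.
have E : (fun h : R => h^-1 *: (f (x + (h *: 1 + s) *: u) - f (x + s *: u)))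
       = (fun h : R => h^-1 *: (f (h *: u + (x + s *: u)) - f (x + s *: u))).
  apply/funext => h; congr (_ *: (f _ - _)).
  by rewrite scalerDl addrCA; congr (_ *: _ + _); exact: mulr1.
by case=> ex val; split; [rewrite /derivable E|rewrite /derive E].
Qed.

Lemma MVT_line (R : realType) (V : normedModType R) (f g : V -> R) (x u : V)
    (h : R) : 0 < h -> (forall y, is_derive y u f (g y)) ->
  exists2 s, 0 < s < h & f (x + h *: u) - f x = h * g (x + s *: u).
Proof.
move=> h0 df.
have dl (s : R) : is_derive s 1 (fun r => f (x + r *: u)) (g (x + s *: u)).
  exact: is_derive_line.
have [|s sh] := @MVT R (fun r => f (x + r *: u)) (fun s => g (x + s *: u)) 0 h
    h0 (fun s _ => dl s).
  apply: derivable_within_continuous => s _.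
  exact: (@ex_derive _ _ _ _ _ _ _ (dl s)).
rewrite scale0r addr0 subr0 mulrC => E; exists s; last exact: E.
by move: sh; rewrite in_itv.
Qed.

(** The mean value theorem is used twice: along [u] for [y |-> f (y + h *: w) - f y], whose
    derivative is a difference of values of [g], then along [w] for [g] itself. *)
Lemma second_difference (R : realType) (V : normedModType R)
    (f g k : V -> R) (x u w : V) (h : R) : 0 < h ->
  (forall y, is_derive y u f (g y)) -> (forall y, is_derive y w g (k y)) ->
  exists s r, [/\ 0 < s < h, 0 < r < h &
    f (x + h *: u + h *: w) - f (x + h *: u) - (f (x + h *: w) - f x)
    = h ^+ 2 * k (x + s *: u + r *: w)].
Proof.
move=> h0 fg gk.
have dfw y :
    is_derive y u (fun y => f (y + h *: w) - f y) (g (y + h *: w) - g y).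
  apply: is_deriveB; have [ex val] := fg (y + h *: w).
  have E : (fun l : R => l^-1 *: (f (l *: u + y + h *: w) - f (y + h *: w)))
    = (fun l : R => l^-1 *: (f (l *: u + (y + h *: w)) - f (y + h *: w))).
    by apply/funext => l; rewrite addrA.
  by split; [rewrite /derivable E|rewrite /derive E].
have [s sh E] := MVT_line x h0 dfw.
have [r rh E'] := MVT_line (x + s *: u) h0 gk.
exists s, r; split => //.
rewrite expr2 -mulrA -E' -E addrAC !opprB; ring.
Qed.

Lemma continuous_at_segments (R : realType) (V : normedModType R) (k : V -> R)
    (x u w : V) (e : R) : {for x, continuous k} -> 0 < e ->
  exists2 d, 0 < d & forall s r, 0 < s < d -> 0 < r < d ->
    `|k (x + s *: u + r *: w) - k x| < e.
Proof.
move=> kx e0; have /cvgrPdist_lt/(_ e e0) := kx.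
move=> /nbhs_normP[d /= d0 kd].
(* The [+ 1] keeps [N] positive when both vectors vanish, and it makes the final estimate strict. *)
pose N := `|u| + `|w| + 1.
have N0 : 0 < N by rewrite ltr_wpDl// addr_ge0.
exists (d / N); first exact: divr_gt0.
move=> s r /andP[s0 sd] /andP[r0 rd]; rewrite distrC; apply: kd => /=.
rewrite -addrA opprD addNKr normrN (le_lt_trans (ler_normD _ _))//.
rewrite !normrZ !gtr0_norm//.
have h0 : 0 < d / N by exact: divr_gt0.
rewrite -[ltRHS](@divfK _ N) ?gt_eqF// {2}/N !mulrDr mulr1.
by rewrite ltr_pwDr// lerD// ler_wpM2r// ltW.
Qed.

(* Both iterated derivatives are the limit of the second difference of [f] along
   [u] and [w], divided by [h ^+ 2]. *)
Lemma deriveC (R : realType) (V : normedModType R) (f : V -> R) (u w x : V) :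
  (forall y, differentiable f y) ->
  (forall y, differentiable ('D_u f) y) ->
  (forall y, differentiable ('D_w f) y) ->
  continuous ('D_w ('D_u f)) -> continuous ('D_u ('D_w f)) ->
  'D_w ('D_u f) x = 'D_u ('D_w f) x.
Proof.
move=> df dfu dfw cuw cwu.
have der (g : V -> R) v : (forall y, differentiable g y) ->
    forall y, is_derive y v g ('D_v g y).
  by move=> dg y; apply/derivableP/diff_derivable.
apply/eqP; rewrite -subr_eq0 -normr_le0; apply/ler_addgt0Pl => e e0.
rewrite addr0.
have e20 : 0 < e / 2 by exact: divr_gt0.
have [d1 d10 H1] := @continuous_at_segments R V _ x u w _ (cuw x) e20.
have [d2 d20 H2] := @continuous_at_segments R V _ x w u _ (cwu x) e20.
(* With this step, the intermediate points of both orders of differentiation fall within the range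
   of the continuity estimates. *)
pose h := Num.min d1 d2; have h0 : 0 < h by rewrite lt_min d10.
have [s [r [/andP[s0 sh] /andP[r0 rh] E]]] :=
  second_difference x h0 (der _ u df) (der _ w dfu).
have [s' [r' [/andP[s'0 s'h] /andP[r'0 r'h] E']]] :=
  second_difference x h0 (der _ w df) (der _ u dfw).
(* The second difference is symmetric in [u] and [w], so the two mixed derivatives agree at their
   respective intermediate points. This common value links the two sides at [x]. *)
have {}E : 'D_w ('D_u f) (x + s *: u + r *: w)
         = 'D_u ('D_w f) (x + s' *: w + r' *: u).
  apply: (@mulfI _ (h ^+ 2)); first by rewrite expf_neq0 ?gt_eqF.
  by rewrite -E -E' [x + h *: w + _]addrAC; ring.
have := H1 s r; have := H2 s' r'; move: sh rh s'h r'h.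
rewrite !lt_min => /andP[-> _] /andP[-> _] /andP[_ ->] /andP[_ ->].
rewrite s0 r0 s'0 r'0 => /(_ isT isT) K2 /(_ isT isT) K1.
rewrite [e]splitr -[X in `|X|](subrKA ('D_w ('D_u f) (x + s *: u + r *: w))).
apply: (le_trans (ler_normD _ _)); apply: lerD; apply: ltW.
  by rewrite distrC; exact: K1.
by rewrite E; exact: K2.
Qed.

Lemma smooth_deriveC (R : realType) (V : normedModType R) (f : V -> R)
    (u w x : V) : smooth f -> 'D_w ('D_u f) x = 'D_u ('D_w f) x.
Proof.
move=> /(_ 2) [df d2]; have [du cu] := d2 u; have [dw cw] := d2 w.
exact: deriveC.
Qed.

(** The slice and the function on the product have the same difference quotients, because the
    increment [(v, 0)] leaves the second coordinate fixed. *)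
Lemma is_derive_fst (R : realType) (V W : normedModType R) (f : V * W -> R)
    (v z : V) (t : W) (d : R) :
  is_derive (z, t) (v, 0) f d -> is_derive z v (fun w => f (w, t)) d.
Proof.
have E : (fun h : R => h^-1 *: (f (h *: v + z, t) - f (z, t)))
       = (fun h : R => h^-1 *: (f (h *: (v, 0) + (z, t)) - f (z, t))).
  apply/funext => h; congr (_ *: (f _ - _)).
  by rewrite -[RHS]/(h *: v + z, h *: 0 + t) scaler0 add0r.
by case=> ex val; split; [rewrite /derivable E|rewrite /derive E].
Qed.

Lemma is_derive_snd (R : realType) (V W : normedModType R) (f : V * W -> R)
    (z : V) (v t : W) (d : R) :
  is_derive (z, t) (0, v) f d -> is_derive t v (fun s => f (z, s)) d.
Proof.
have E : (fun h : R => h^-1 *: (f (z, h *: v + t) - f (z, t)))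
       = (fun h : R => h^-1 *: (f (h *: (0, v) + (z, t)) - f (z, t))).
  apply/funext => h; congr (_ *: (f _ - _)).
  by rewrite -[RHS]/(h *: 0 + z, h *: v + t) scaler0 add0r.
by case=> ex val; split; [rewrite /derivable E|rewrite /derive E].
Qed.

(** * One-sided limits and differentiation under the integral sign *)

(** Properness makes limits of difference quotients over the interval unique. A nearby point is
    found to the right of [t] when [t < b], and to the left when [t = b], where [a < b] leaves
    room. *)
Lemma within_itv_dnbhs_proper (R : realType) (a b t : R) : a < b ->
  t \in `[a, b] -> ProperFilter (within `[a, b]%classic t^').
Proof.
move=> ab; rewrite in_itv /= => /andP[at_ tb].
suff K : forall e : R, 0 < e ->
    exists s, [/\ `|t - s| < e, s != t & a <= s <= b].
  split; last exact: within_filter.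
  move=> -[e /= e0 H]; have [s [se st sI]] := K e e0.
  by apply: (H s se st); rewrite /= in_itv.
move=> e e0; have [tb'|bt] := ltP t b.
  have m0 : 0 < Num.min (e / 2) (b - t) by rewrite lt_min divr_gt0 //= subr_gt0.
  exists (t + Num.min (e / 2) (b - t)); split.
  - rewrite opprD addNKr normrN gtr0_norm// gt_min.
    by rewrite ltr_pdivrMr// ltr_pMr// ltr1n.
  - by rewrite -subr_eq0 addrAC subrr add0r gt_eqF.
  - rewrite (le_trans at_) ?lerDl ?(ltW m0)//=.
    by rewrite -lerBrDl ge_min lexx orbT.
have m0 : 0 < Num.min (e / 2) (t - a).
  by rewrite lt_min divr_gt0 //= subr_gt0 (lt_le_trans ab).
exists (t - Num.min (e / 2) (t - a)); split.
- rewrite opprB addrCA subrr addr0 gtr0_norm// gt_min.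
  by rewrite ltr_pdivrMr// ltr_pMr// ltr1n.
- by rewrite -subr_eq0 addrAC subrr add0r oppr_eq0 gt_eqF.
- by rewrite lerBrDl -lerBrDr ge_min lexx orbT /= (le_trans _ tb)// gerBl ltW.
Qed.

Lemma cvg_within_eq (T : Type) (U : topologicalType) (A : set T)
    (F : set_system T) (f h : T -> U) (l : U) : Filter F ->
  (forall x, A x -> f x = h x) -> h @ F --> l -> f @ within A F --> l.
Proof.
move=> FF fh hl B /hl; rewrite /nbhs /= => HB.
by rewrite /within /=; apply: filterS HB => x Bx Ax /=; rewrite fh.
Qed.

(** By linearity the quotient of the integrals is the integral of the quotients, and dominated
    convergence applies along every sequence tending to [t] through points other than [t]. *)
Lemma cvg_Rintegral_quotient d (T : measurableType d) (R : realType)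
    (mu : {measure set T -> \bar R}) (I : set R) (t : R) (f : R -> T -> R)
    (df g : T -> R) :
  I t ->
  (forall s, I s -> mu.-integrable setT (EFin \o f s)) ->
  mu.-integrable setT (EFin \o df) -> mu.-integrable setT (EFin \o g) ->
  (forall s x, I s -> s != t -> `|(f s x - f t x) / (s - t)| <= g x) ->
  (forall x, `|df x| <= g x) ->
  (forall x, (f s x - f t x) / (s - t) @[s --> within I t^'] --> df x) ->
  (\int[mu]_(x in setT) f s x - \int[mu]_(x in setT) f t x) / (s - t)
    @[s --> within I t^'] --> \int[mu]_(x in setT) df x.
Proof.
move=> It intf intdf intg qg dfg cvgq.
(* Taking the limit [df x] as the value outside [I] turns convergence within [I] into convergence on
   a full punctured neighbourhood, where the sequential criterion holds; [g] still dominates. *)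
pose q s x := if s \in I then (f s x - f t x) / (s - t) else df x.
apply: (@cvg_within_eq _ _ _ _ _ (fun s => \int[mu]_(x in setT) q s x)).
  move=> s Is; rewrite /q mem_set// RintegralZr//; last first.
    have := @integrableB _ _ _ mu setT measurableT _ _ (intf _ Is) (intf _ It).
    by apply: eq_integrable => // x _; rewrite /= EFinB.
  by rewrite RintegralB//; exact: intf.
apply/cvgr_dnbhsP => u [ut ucvg].
have qcvg x : q s x @[s --> t^'] --> df x.
  apply/cvgrPdist_lt => e e0; have /cvgrPdist_lt/(_ e e0) W := cvgq x.
  apply: (@filterS _ t^' _ _ _ _ W) => s H; rewrite /q.
  case: ifPn => [Is|_]; first exact: H (set_mem Is).
  by rewrite subrr normr0.
have mf s : I s -> measurable_fun setT (f s).
  by move=> Is; apply/measurable_EFinP; exact: measurable_int (intf _ Is).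
have mq n : measurable_fun setT (q (u n)).
  rewrite /q; have [Iu|_] := boolP (u n \in I); last first.
    by apply/measurable_EFinP; exact: measurable_int intdf.
  apply: measurable_funM => //; apply: measurable_funB; apply: mf => //.
  exact: set_mem.
have qu x : (q (u n) x)%:E @[n --> \oo] --> (df x)%:E.
  apply: cvg_EFin; first exact: nearW.
  by have /cvgr_dnbhsP := qcvg x; apply.
have [||intdf' _ C] := @dominated_convergence _ _ _ mu setT measurableT
  (fun n => EFin \o q (u n)) (EFin \o df) (EFin \o g)
  (fun n => (measurable_EFinP _ _).2 (mq n))
  (measurable_int _ intdf) _ intg _.
- by apply: aeW => x _; exact: qu.
- apply: aeW => x n _ /=; rewrite lee_fin /q.
  by case: ifPn => // /set_mem Iu; exact: qg.
apply: fine_cvg; rewrite fineK//.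
exact: integrable_fin_num.
Qed.

(** * Calculus of complex-valued functions of time *)

Section ComplexDerivative.
Context {R : realType}.
Local Notation C := R[i].
Local Notation Re := complex.Re.
Local Notation Im := complex.Im.
Implicit Types (f g : R -> C) (x y df dg : C).

Lemma ReM x y : Re (x * y) = Re x * Re y - Im x * Im y.
Proof. by case: x; case: y. Qed.

Lemma ImM x y : Im (x * y) = Re x * Im y + Im x * Re y.
Proof. by case: x; case: y. Qed.

Lemma ReD x y : Re (x + y) = Re x + Re y.
Proof. by case: x; case: y. Qed.

Lemma ImD x y : Im (x + y) = Im x + Im y.
Proof. by case: x; case: y. Qed.

Lemma Re_conjc x : Re (conjc x) = Re x.
Proof. by case: x. Qed.

Lemma Im_conjc x : Im (conjc x) = - Im x.
Proof. by case: x. Qed.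

Lemma complex_eq x y : Re x = Re y -> Im x = Im y -> x = y.
Proof. by case: x; case: y => ? ? ? ? /= -> ->. Qed.

Lemma quotientE f t s : quotient f t s =
  ((Re (f s) - Re (f t)) / (s - t)) +i* ((Im (f s) - Im (f t)) / (s - t)).
Proof.
rewrite /quotient -(fmorphV (real_complex R)) /=.
case: (f s) (f t) => [a b] [c d].
by apply: complex_eq; rewrite /= !mulr0 ?subr0 ?add0r.
Qed.

Lemma Im_le_norm x : `|Im x|%:C <= `|x|.
Proof.
rewrite normc_def lecR -sqrtr_sqr ler_sqrt ?lerDr ?sqr_ge0//.
by rewrite addr_ge0 ?sqr_ge0.
Qed.

(** The derivative here is two-sided, on the whole line. It serves for the smooth extension in time,
    whereas [has_dt] only sees the interval. *)
Definition is_cderive f (t : R) (df : C) : Prop :=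
  is_derive t 1 (fun s => Re (f s)) (Re df) /\
  is_derive t 1 (fun s => Im (f s)) (Im df).

Lemma is_cderive_cst x t : is_cderive (fun=> x) t 0.
Proof. by split; exact: is_derive_cst. Qed.

Lemma is_cderiveD f g t df dg : is_cderive f t df -> is_cderive g t dg ->
  is_cderive (fun s => f s + g s) t (df + dg).
Proof.
move=> [fr fi] [gr gi]; split.
- under eq_fun do rewrite ReD; rewrite ReD; exact: is_deriveD.
- under eq_fun do rewrite ImD; rewrite ImD; exact: is_deriveD.
Qed.

Lemma is_cderiveM f g t df dg : is_cderive f t df -> is_cderive g t dg ->
  is_cderive (fun s => f s * g s) t (df * g t + f t * dg).
Proof.
move=> [fr fi] [gr gi]; split.
- under eq_fun do rewrite ReM.
  apply: (is_derive_eq (is_deriveB (is_deriveM fr gr) (is_deriveM fi gi))).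
  by rewrite /= ReD !ReM /GRing.scale /=; ring.
- under eq_fun do rewrite ImM.
  apply: (is_derive_eq (is_deriveD (is_deriveM fr gi) (is_deriveM fi gr))).
  by rewrite /= ImD !ImM /GRing.scale /=; ring.
Qed.

Lemma is_cderiveZ x f t df : is_cderive f t df ->
  is_cderive (fun s => x * f s) t (x * df).
Proof.
by move=> /(is_cderiveM (is_cderive_cst x t)); rewrite mul0r add0r.
Qed.

Lemma is_cderive_conj f t df : is_cderive f t df ->
  is_cderive (fun s => conjc (f s)) t (conjc df).
Proof.
move=> [fr fi]; split.
- by under eq_fun do rewrite Re_conjc; rewrite Re_conjc.
- under eq_fun do rewrite Im_conjc; rewrite Im_conjc; exact: is_deriveN.
Qed.

Lemma is_derive_cvg_dnbhs (h : R -> R) (t d : R) : is_derive t 1 h d ->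
  (h s - h t) / (s - t) @[s --> t^'] --> d.
Proof.
case=> ex <-; have /cvgrPdist_lt H := ex.
apply/cvgrPdist_lt => e /H[/= r r0 K]; exists r => //= s st sdt.
have := K (s - t); rewrite /ball /= sub0r opprB subr_eq0 => /(_ st sdt).
by rewrite [(s - t) *: 1]mulr1 subrK [_ *: _]mulrC.
Qed.

Lemma has_dtE (I : set R) f t df : has_dt I f t df <->
  ((Re (f s) - Re (f t)) / (s - t) @[s --> within I t^'] --> Re df) /\
  ((Im (f s) - Im (f t)) / (s - t) @[s --> within I t^'] --> Im df).
Proof.
rewrite /has_dt.
have -> : (fun s => Re (quotient f t s)) =
    (fun s => (Re (f s) - Re (f t)) / (s - t)).
  by apply/funext => s; rewrite quotientE.
have -> // : (fun s => Im (quotient f t s)) =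
    (fun s => (Im (f s) - Im (f t)) / (s - t)).
by apply/funext => s; rewrite quotientE.
Qed.

(** Passes from an extension [g] to the given [f]: the limit within [I] is a restriction of the
    two-sided limit, so end points need no separate treatment. *)
Lemma is_cderive_has_dt (I : set R) f g t df : I t ->
  (forall s, I s -> f s = g s) -> is_cderive g t df -> has_dt I f t df.
Proof.
move=> It fg [gr gi]; apply/has_dtE; split.
- apply: (cvg_within_eq _ _ (is_derive_cvg_dnbhs gr)) => s Is /=.
  by rewrite !fg.
- apply: (cvg_within_eq _ _ (is_derive_cvg_dnbhs gi)) => s Is /=.
  by rewrite !fg.
Qed.

Lemma has_dt_dt (a b t : R) f df : a < b -> t \in `[a, b] ->
  has_dt `[a, b]%classic f t df -> dt `[a, b]%classic f t = df.
Proof.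
move=> ab tab [fr fi]; have P := within_itv_dnbhs_proper ab tab.
apply: complex_eq => /=; exact: cvg_lim.
Qed.

(** By the mean value theorem the quotient is a value of [dh] between [s] and [t], hence at a point
    of [[a, b]], where the bound is available. *)
Lemma quotient_bound (a b : R) (h dh : R -> R) (g s t : R) :
  (forall r : R, is_derive r 1 h (dh r)) ->
  (forall r, r \in `[a, b] -> `|dh r| <= g) ->
  s \in `[a, b] -> t \in `[a, b] -> s != t ->
  `|(h s - h t) / (s - t)| <= g.
Proof.
move=> hd hb.
wlog st : s t / s < t => [W sI tI sdt|].
  have [st|ts|E] := ltgtP s t; [exact: W| |by rewrite E eqxx in sdt].
  by rewrite -[_ / _]mulrNN -invrN !opprB; apply: W => //; rewrite eq_sym.
rewrite !in_itv /= => /andP[as_ sb] /andP[at_ tb] _.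
have [|c /[!in_itv]/= /andP[sc ct] E] := @MVT R h dh s t st (fun r _ => hd r).
  apply: derivable_within_continuous => r _.
  exact: (@ex_derive _ _ _ _ _ _ _ (hd r)).
rewrite -[_ / _]mulrNN -invrN !opprB E mulfK ?subr_eq0 ?gt_eqF//.
by apply: hb; rewrite in_itv /= (le_trans as_ (ltW sc)) (le_trans (ltW ct) tb).
Qed.

End ComplexDerivative.

(** * The momentum operator commutes with the time derivative *)

Section Momentum.
Context {R : realType}.
Local Notation C := R[i].
Local Notation Re := complex.Re.
Local Notation Im := complex.Im.
Local Notation Z := (phase R).
Implicit Types (f : Z -> C) (F : Z * R -> C) (z : Z) (t : R).

Lemma momentumE (hbar : R) f z (j : 'I_3) :
  momentum hbar f z 0 j = - ('i%C * hbar%:C) * partial (lshift 3 j) f z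
    + 2^-1 * f z * (z 0 (rshift 3 j))%:C.
Proof. by rewrite !mxE. Qed.

Definition time_partial F t z : C :=
  'D_(0, 1) (fun y => Re (F y)) (z, t) +i* 'D_(0, 1) (fun y => Im (F y)) (z, t).

Lemma smooth_is_derive (V : normedModType R) (u : V -> R) (v x : V) :
  smooth u -> is_derive x v u ('D_v u x).
Proof. by move=> /(_ 1) [du _]; exact/derivableP/diff_derivable. Qed.

Lemma smooth_derive (V : normedModType R) (u : V -> R) (v : V) :
  smooth u -> smooth ('D_v u).
Proof. by move=> su n; have [_ /(_ v)] := su n.+1. Qed.

Lemma is_cderive_time F z t : smoothC F ->
  is_cderive (fun s => F (z, s)) t (time_partial F t z).
Proof.
move=> [sr si]; split => /=.
- exact: (is_derive_snd (smooth_is_derive _ _ sr)).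
- exact: (is_derive_snd (smooth_is_derive _ _ si)).
Qed.

(** The derivative of a slice along [v] is the derivative of [u] along [(v, 0)], and the time
    derivative is the one along [(0, 1)]; the claim is then the symmetry of second derivatives on
    the product. *)
Lemma smooth_partialC (V : normedModType R) (u : V * R -> R) (v z : V) t :
  smooth u ->
  is_derive t 1 (fun s => 'D_v (fun w => u (w, s)) z)
    ('D_v (fun w => 'D_(0, 1) u (w, t)) z).
Proof.
move=> su.
have E (s : R) : 'D_v (fun w => u (w, s)) z = 'D_(v, 0) u (z, s).
  by have [_] := is_derive_fst (smooth_is_derive ((v, 0) : V * R) (z, s) su).
under eq_fun do rewrite E.
have [_ ->] := is_derive_fst (smooth_is_derive ((v, 0) : V * R) (z, t)
  (smooth_derive ((0, 1) : V * R) su)).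
rewrite -(smooth_deriveC ((v, 0) : V * R) (0, 1) (z, t) su).
exact: (is_derive_snd (smooth_is_derive ((0, 1) : V * R) (z, t)
  (smooth_derive ((v, 0) : V * R) su))).
Qed.

Lemma is_cderive_partial F (k : 'I_(3 + 3)) z t : smoothC F ->
  is_cderive (fun s => partial k (fun w => F (w, s)) z) t
    (partial k (time_partial F t) z).
Proof. by move=> [sr si]; split; exact: smooth_partialC. Qed.

Lemma is_cderive_momentum (hbar : R) F (j : 'I_3) z t : smoothC F ->
  is_cderive (fun s => momentum hbar (fun w => F (w, s)) z 0 j) t
    (momentum hbar (time_partial F t) z 0 j).
Proof.
move=> sF; under eq_fun do rewrite momentumE; rewrite momentumE.
apply: is_cderiveD; first exact/is_cderiveZ/is_cderive_partial.
under eq_fun do rewrite mulrAC; rewrite mulrAC.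
exact/is_cderiveZ/is_cderive_time.
Qed.

Lemma partialZ (k : 'I_(3 + 3)) (c : C) f z :
  (forall v, derivable (fun w => Re (f w)) z v) ->
  (forall v, derivable (fun w => Im (f w)) z v) ->
  partial k (fun w => c * f w) z = c * partial k f z.
Proof.
move=> dr di; apply: complex_eq; rewrite /partial /= ?ReM ?ImM /=.
- under eq_fun do rewrite ReM.
  rewrite deriveB; [|exact: derivableZ..].
  by rewrite !deriveZ.
- under eq_fun do rewrite ImM.
  rewrite deriveD; [|exact: derivableZ..].
  by rewrite !deriveZ.
Qed.

Lemma momentumZ (hbar : R) (c : C) f z :
  (forall v, derivable (fun w => Re (f w)) z v) ->
  (forall v, derivable (fun w => Im (f w)) z v) ->
  momentum hbar (fun w => c * f w) z = c *: momentum hbar f z.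
Proof.
move=> dr di; apply/rowP => j; rewrite [RHS]mxE !momentumE partialZ//; ring.
Qed.

(** Supplies the derivability that [partialZ] and [momentumZ] require for pulling a complex constant
    out of the spatial derivatives. *)
Lemma time_partial_derivable F t z : smoothC F ->
  (forall v, derivable (fun w => Re (time_partial F t w)) z v) /\
  (forall v, derivable (fun w => Im (time_partial F t w)) z v).
Proof.
move=> [sr si]; split => /= v.
- by have [] := is_derive_fst
    (smooth_is_derive (v, 0) (z, t) (smooth_derive ((0, 1) : Z * R) sr)).
- by have [] := is_derive_fst
    (smooth_is_derive (v, 0) (z, t) (smooth_derive ((0, 1) : Z * R) si)).
Qed.

End Momentum.

(** * Linearity of the integral, and time derivatives of complex integrals *)

Section Averages.
Context {R : realType}.
Local Notation C := R[i].
Local Notation Re := complex.Re.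
Local Notation Im := complex.Im.
Local Notation Z := (phase R).

Lemma integral_R6_lin (c d : R) (f g : Z -> R) :
  integrable_R6 f -> integrable_R6 g ->
  integrable_R6 (fun z => c * f z + d * g z) /\
  integral_R6 (fun z => c * f z + d * g z)
    = c * integral_R6 f + d * integral_R6 g.
Proof.
move=> fi gi.
have sci e (h : Z -> R) : integrable_R6 h -> integrable_R6 (fun z => e * h z).
  by move=> hi; exact: (integrableZl measurableT e hi).
split; first exact: (integrableD measurableT (sci c f fi) (sci d g gi)).
rewrite /integral_R6 RintegralD//; [|exact: (sci c f fi)|exact: (sci d g gi)].
by rewrite !RintegralZl.
Qed.

(** The real and imaginary parts are treated separately with the same dominating [g], since each is
    bounded by the modulus. *)
Lemma has_dt_integralC (I : set R) (t : R) (B : R -> Z -> C) (D : Z -> C)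
    (g : Z -> R) :
  I t -> (forall s, I s -> integrableC (B s)) -> integrableC D ->
  integrable_R6 g ->
  (forall s z, I s -> s != t ->
    `|(Re (B s z) - Re (B t z)) / (s - t)| <= g z /\
    `|(Im (B s z) - Im (B t z)) / (s - t)| <= g z) ->
  (forall z, `|D z| <= (g z)%:C) ->
  (forall z, has_dt I (B ^~ z) t (D z)) ->
  has_dt I (fun s => integralC (B s)) t (integralC D).
Proof.
move=> It Bi [Dr Di] gi qg Dg dB.
have Dgr z : `|Re (D z)| <= g z by rewrite -lecR (le_trans (normc_ge_Re _)).
have Dgi z : `|Im (D z)| <= g z by rewrite -lecR (le_trans (Im_le_norm _)).
apply/has_dtE; split.
- apply: (cvg_Rintegral_quotient (g := g \o of_coords) It _ Dr gi) => //=.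
  + by move=> s Is; have [] := Bi s Is.
  + by move=> s x Is st; have [] := qg s (of_coords x) Is st.
  + by move=> x; have /has_dtE[] := dB (of_coords x).
- apply: (cvg_Rintegral_quotient (g := g \o of_coords) It _ Di gi) => //=.
  + by move=> s Is; have [] := Bi s Is.
  + by move=> s x Is st; have [] := qg s (of_coords x) Is st.
  + by move=> x; have /has_dtE[] := dB (of_coords x).
Qed.

End Averages.

(** * Evolution of the momentum and of its average *)

Theorem theorem4p4 (R : realType) (hbar : R) (hbar_gt0 : 0 < hbar)
  (a b : R) (ab : a < b) (H : phase R -> R) (H_smooth : smooth H)
  (chi : R -> phase R -> R[i])
  (chi_wave : van_hove_wave hbar a b chi)
  (chi_regular : regular_decaying hbar H a b chi)
  (chi_solves : solves_liouville hbar H a b chi) :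
  (forall t z, t \in `[a, b] ->
     let Lchi := liouvillian hbar H (chi t) in
     let rhs := - (grad_q Lchi z + ('i%C / (2 * hbar%:C) * Lchi z) *: ppart z) in
     has_dt_vec `[a, b]%classic (fun s => momentum hbar (chi s) z) t rhs /\
     rhs = - ('i%C / hbar%:C) *: momentum hbar Lchi z) /\
  (forall t, t \in `[a, b] ->
     has_dt_vec `[a, b]%classic (fun s => average (momentum hbar) (chi s)) t
       (\row_j (2 / hbar * complex.Im
          (inner (component (momentum hbar) j (chi t))
                 (liouvillian hbar H (chi t))))%:C)).
Proof.
have [F sF Fchi] := jointly_smooth chi_regular.
have chiF s : s \in `[a, b] -> chi s = fun z => F (z, s).
  by move=> sI; apply/funext => z; rewrite Fchi.
pose E := time_partial F.
pose k : R[i] := 'i%C * hbar%:C.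
have h0 : hbar%:C != 0 :> R[i].
  by rewrite -[0]/(0%:C) (inj_eq (@complexI _)) gt_eqF.
have ii : 'i%C * 'i%C = -1 :> R[i] by rewrite -expr2 sqr_i.
have ikE (x : R[i]) : 'i%C / hbar%:C * (k * x) = - x.
  have -> : 'i%C / hbar%:C * (k * x) = 'i%C * 'i%C * x by rewrite /k; field.
  by rewrite ii mulN1r.
(* The equation, read on the extension: the one-sided [dt] of [chi] is the time partial of [F], so
   the Liouvillian of [chi t] is [k * E t]. *)
have LE t : t \in `[a, b] -> liouvillian hbar H (chi t) = fun z => k * E t z.
  move=> tI; apply/funext => z; rewrite -chi_solves//; congr (_ * _).
  apply: has_dt_dt => //.
  apply: is_cderive_has_dt (is_cderive_time z t sF) => //.
  by move=> s sI; rewrite chiF.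
have PL t z : t \in `[a, b] ->
    momentum hbar (liouvillian hbar H (chi t)) z = k *: momentum hbar (E t) z.
  move=> tI; have [dr di] := time_partial_derivable t z sF.
  rewrite (LE t tI); exact: (momentumZ hbar k dr di).
split=> [t z tI Lchi rhs|t tI j].
  (* Since ['i / (2 * hbar)] times [k] is [- 2^-1], the [p] term changes sign and the right-hand
     side becomes the momentum of [E t]. *)
  have rhsE : rhs = momentum hbar (E t) z.
    apply/rowP => j; rewrite !mxE /Lchi (LE t tI).
    have [dr di] := time_partial_derivable t z sF.
    rewrite (partialZ _ k dr di).
    have -> : 'i%C / (2 * hbar%:C) * (k * E t z)
        = 2^-1 * ('i%C / hbar%:C * (k * E t z)).
      by field; rewrite h0.
    by rewrite ikE /k; ring.
  split.
  - move=> j; rewrite rhsE.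
    apply: is_cderive_has_dt (is_cderive_momentum hbar j z t sF) => //.
    by move=> s sI; rewrite chiF.
  - rewrite rhsE (PL t z tI) scalerA mulNr -[X in _ * X]mulr1 ikE opprK.
    by rewrite scale1r.
(* [P] is built on [F] rather than [chi], so that [conjc F * P] is differentiable at every real
   time, as the mean value theorem requires; it agrees with [B] on [[a, b]]. *)
pose P s z := momentum hbar (fun w => F (w, s)) z 0 j.
pose B s := bracket (chi s) (component (momentum hbar) j (chi s)).
pose D s z := conjc (E s z) * P s z
  + conjc (F (z, s)) * momentum hbar (E s) z 0 j.
have BE s z : s \in `[a, b] -> B s z = conjc (F (z, s)) * P s z.
  by move=> sI; rewrite /B /bracket /component chiF.
have dBF s z : is_cderive (fun s => conjc (F (z, s)) * P s z) s (D s z).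
  apply: is_cderiveM; last exact: is_cderive_momentum.
  exact/is_cderive_conj/is_cderive_time.
have dB s z : s \in `[a, b] -> has_dt `[a, b]%classic (B ^~ z) s (D s z).
  by move=> sI; apply: is_cderive_has_dt (dBF s z) => // r rI; exact: BE.
have [g gi dg] := average_dominated chi_regular j.
(* Uniqueness of the limit identifies [dt] with [D], so the assumed domination becomes a bound on
   [D]. *)
have Dg s z : s \in `[a, b] -> `|D s z| <= (g z)%:C.
  by move=> sI; rewrite -(has_dt_dt ab sI (dB s z sI)); exact: dg.
have [Li PLi LP] := momentum_symmetric chi_regular tI j.
set L := liouvillian hbar H (chi t) in Li PLi LP *.
pose b2 := bracket (chi t) (component (momentum hbar) j L).
pose b3 := bracket (component (momentum hbar) j (chi t)) L.
have kE z : E t z = - ('i%C / hbar%:C) * L z.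
  by rewrite mulNr /L (LE t tI) ikE opprK.
have kP z : momentum hbar (E t) z 0 j
    = - ('i%C / hbar%:C) * momentum hbar L z 0 j.
  by rewrite /L (PL t z tI) [in RHS]mxE mulNr ikE opprK.
have DE z : D t z = ('i%C / hbar%:C) * (conjc (b3 z) - b2 z).
  rewrite /D /P kE kP /b2 /b3 /bracket /component chiF//.
  have conjik : conjc ('i%C / hbar%:C) = - ('i%C / hbar%:C) :> R[i].
    by rewrite -(fmorphV (real_complex R)); apply: complex_eq => /=; ring.
  move: ('i%C / hbar%:C) conjik => c conjik.
  rewrite !(rmorphM, rmorphN) /= conjcK conjik; ring.
(* Multiplication by ['i / hbar] exchanges real and imaginary parts up to sign, so [D t] reduces to
   real combinations of the parts of [b2] and [b3]. *)
have ikR (x : R[i]) : 'i%C / hbar%:C * x =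
    (- hbar^-1 * complex.Im x) +i* (hbar^-1 * complex.Re x).
  rewrite -(fmorphV (real_complex R)) /=.
  by case: x => x y; apply: complex_eq => /=; ring.
have DRe z : complex.Re (D t z) =
    hbar^-1 * complex.Im (b3 z) + hbar^-1 * complex.Im (b2 z).
  by rewrite DE ikR /= ImD Im_conjc; case: (b2 z) => ? ? /=; ring.
have DIm z : complex.Im (D t z) =
    hbar^-1 * complex.Re (b3 z) + - hbar^-1 * complex.Re (b2 z).
  by rewrite DE ikR /= ReD Re_conjc; case: (b2 z) => ? ? /=; ring.
have [b3r b3i] := Li; have [b2r b2i] := PLi.
have [DReI DReV] := integral_R6_lin hbar^-1 hbar^-1 b3i b2i.
have [DImI DImV] := integral_R6_lin hbar^-1 (- hbar^-1) b3r b2r.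
have DI : integrableC (D t).
  by rewrite /integrableC (funext DRe) (funext DIm); exact: conj.
have <- : integralC (D t) = (\row_j (2 / hbar * complex.Im
    (inner (component (momentum hbar) j (chi t)) L))%:C) 0 j.
  rewrite mxE /integralC (funext DRe) (funext DIm) DReV DImV.
  (* Symmetry of the momentum gives [b2] and [b3] the same integral: the imaginary parts add up,
     which produces the factor 2, and the real parts cancel. *)
  have [Er Ei] := (congr1 (@complex.Re R) LP,
    congr1 (@complex.Im R) LP).
  by move: Er Ei => /= <- <-; apply: complex_eq => /=; ring.
have -> : (fun s => average (momentum hbar) (chi s) 0 j) =
    fun s => integralC (B s).
  by apply/funext => s; rewrite mxE; reflexivity.
have Bint s : s \in `[a, b] -> integrableC (B s).
  by move=> sI; exact: average_defined chi_regular _ sI j.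
have DgR s z : s \in `[a, b] -> `|complex.Re (D s z)| <= g z.
  by move=> sI; rewrite -lecR; exact: le_trans (normc_ge_Re _) (Dg s z sI).
have DgI s z : s \in `[a, b] -> `|complex.Im (D s z)| <= g z.
  by move=> sI; rewrite -lecR; exact: le_trans (Im_le_norm _) (Dg s z sI).
refine (has_dt_integralC tI Bint DI gi _ (Dg t ^~ tI) (dB t ^~ tI)).
(* The remaining hypothesis is the bound on the difference quotients, which follows from the bound
   on [D] over the whole interval. *)
move=> s z sI st; rewrite (BE s z sI) (BE t z tI); split.
  exact: (quotient_bound (fun r => (dBF r z).1) (DgR ^~ z) sI tI st).
exact: (quotient_bound (fun r => (dBF r z).2) (DgI ^~ z) sI tI st).
Qed.
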